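(* Let $0\le q\le 2$ and let $X$ be a discrete random variable with $n$ values and probabilities $p(x_1),\dots,p(x_n)$ ($p(x_i)\ge0$, $\sum_{i=1}^n p(x_i)=1$). With the choice $h(\lambda,q)=(1+\lambda)^{1-q}$, the Tsallis hypoentropy $H_{\lambda,q}(X)$ is a monotone increasing (i.e. nondecreasing) function of $\lambda>0$.
   Context: The $q$-logarithm is $\ln_q(x)=\frac{x^{1-q}-1}{1-q}$ for $x>0$, $q\neq 1$, with $\ln_1=\log$ (the limit $q\to1$). The Tsallis hypoentropy with $h(\lambda,q)=(1+\lambda)^{1-q}$ is $$H_{\lambda,q}(X)=\frac{(1+\lambda)^{1-q}}{\lambda}\left\{-(1+\lambda)\ln_q\frac{1}{1+\lambda}+\sum_{i=1}^n(1+\lambda p(x_i))\ln_q\frac{1}{1+\lambda p(x_i)}\right\}.$$ *)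

(* Defs.v *)
From mathcomp Require Import all_boot all_order all_algebra.
From mathcomp Require Import reals exp.

Set Implicit Arguments.
Unset Strict Implicit.
Unset Printing Implicit Defensive.

Import Order.TTheory GRing.Theory Num.Theory.
Local Open Scope ring_scope.

(* Only meaningful for [0 < x]: outside this range [powR] and [ln] return
   conventional values. *)
Definition lnq (R : realType) (q x : R) : R :=
  if q == 1 then ln x else (powR x (1 - q) - 1) / (1 - q).

(* A random variable with [n] values enters only through its probabilities
   [p i = p(x_i)]. *)
Definition is_distribution (R : realType) (n : nat) (p : 'I_n -> R) : Prop :=
  (forall i, 0 <= p i) /\ \sum_(i < n) p i = 1.

Definition tsallis_hypoentropy (R : realType) (n : nat) (h : R -> R -> R)
    (q : R) (p : 'I_n -> R) (lambda : R) : R :=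
  h lambda q / lambda *
  (- (1 + lambda) * lnq q (1 / (1 + lambda)) +
   \sum_(i < n) (1 + lambda * p i) * lnq q (1 / (1 + lambda * p i))).

Definition h_power (R : realType) (lambda q : R) : R :=
  powR (1 + lambda) (1 - q).

(* Main.v *)
(* Since x ln_q(1/x) = - x ln_(2-q)(x), put f(z) = - (1-z) ln_(2-q)(1-z).  In the
   variable x = lambda / (1 + lambda), the choice of h turns the hypoentropy into
     sum_i (f((1 - p_i) x) - (1 - p_i) f(x)) / x.
   Each summand is nondecreasing in x: with c = 1 - p_i it equals the integral over
   t in [0, 1] of c (f'(c t x) - f'(t x)), and z |-> f'(c z) - f'(z) is
   nondecreasing because f''(z) <= f''(c z) <= c f''(c z), the second derivative
   f''(z) = - q (1-z)^(q-2) being nonpositive and nonincreasing for 0 <= q <= 2. *)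
Require Import Defs.
From mathcomp Require Import all_boot all_order all_algebra.
From mathcomp Require Import reals exp.
From mathcomp Require Import ring lra.
From mathcomp Require Import normedtype derive realfun.

Import Order.TTheory GRing.Theory Num.Theory.
Import numFieldNormedType.Exports.
Local Open Scope ring_scope.

Lemma is_derive_ge0_le (R : realType) (f df : R -> R) (a b : R) :
  a <= b ->
  (forall x, a <= x <= b -> is_derive x 1 f (df x)) ->
  (forall x, a <= x <= b -> 0 <= df x) ->
  f a <= f b.
Proof.
move=> ab fE df0; rewrite -subr_ge0.
have [|  |c + ->] := @MVT_segment R f df a b ab.
- by move=> x; rewrite in_itv/= => /andP[ax xb]; apply: fE; rewrite !ltW.
- apply: derivable_within_continuous => x; rewrite in_itv/= => xab.
  by have [] := fE x xab.
- by rewrite in_itv/= => cab; rewrite mulr_ge0 ?df0 ?subr_ge0.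
Qed.

Lemma is_derive_comp_scale (R : realType) (f : R -> R) (c x d : R) :
  is_derive (c * x) 1 f d -> is_derive x 1 (fun t => f (c * t)) (c * d).
Proof.
move=> fd; have cd : is_derive x 1 (fun t : R => c * t) c.
  by apply: is_derive_eq; rewrite /GRing.scale/=; ring.
by rewrite mulrC; exact: (@is_derive1_comp R f (fun t => c * t)).
Qed.

Lemma jensen_gap_quotient_le (R : realType) (f f1 f2 : R -> R) (c x y : R) :
  f 0 = 0 ->
  (forall z : R, 0 <= z < 1 -> is_derive z 1 f (f1 z)) ->
  (forall z : R, 0 <= z < 1 -> is_derive z 1 f1 (f2 z)) ->
  (forall z : R, 0 <= z < 1 -> f2 z <= 0) ->
  (forall z w : R, 0 <= z -> z <= w -> w < 1 -> f2 w <= f2 z) ->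
  0 <= c <= 1 -> 0 < x -> x <= y -> y < 1 ->
  (f (c * x) - c * f x) / x <= (f (c * y) - c * f y) / y.
Proof.
move=> f0 fE f1E f2_le0 f2_mono /andP[c0 c1] x0 xy y1.
have y0 : 0 < y := lt_le_trans x0 xy.
have psi_le (z w : R) : 0 <= z -> z <= w -> w < 1 ->
    f1 (c * z) - f1 z <= f1 (c * w) - f1 w.
  move=> z0 zw w1.
  apply: (@is_derive_ge0_le R (fun u => f1 (c * u) - f1 u)
            (fun u => c * f2 (c * u) - f2 u)) => // u /andP[zu uw].
    apply: is_deriveB; last by apply: f1E; lra.
    by apply: is_derive_comp_scale; apply: f1E; nra.
  have f2cu : f2 u <= f2 (c * u) by apply: f2_mono; nra.
  have f2cu0 : f2 (c * u) <= 0 by apply: f2_le0; nra.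
  nra.
have fscaleE (a t : R) : 0 <= a < 1 -> 0 <= t <= 1 ->
    is_derive t 1 (fun t => f (c * a * t) - c * f (a * t))
      (c * a * (f1 (c * (a * t)) - f1 (a * t))).
  move=> /andP[a0 a1] /andP[t0 t1].
  have at0 : 0 <= a * t by nra.
  have at1 : a * t < 1 by nra.
  have D1 : is_derive t 1 (fun t => f (c * a * t)) (c * a * f1 (c * a * t)).
    by apply: is_derive_comp_scale; apply: fE; rewrite -mulrA; nra.
  have D2 : is_derive t 1 (fun t => f (a * t)) (a * f1 (a * t)).
    by apply: is_derive_comp_scale; apply: fE; rewrite at0.
  apply: is_derive_eq.
  rewrite -!mulrA /GRing.scale/=; ring.
(* T 1 - T 0 plays the role of the integral over t in [0, 1]. *)
pose T t := (f (c * y * t) - c * f (y * t)) / y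
          - (f (c * x * t) - c * f (x * t)) / x.
have : T 0 <= T 1.
  (* The chain rule produces factors [c * y] and [c * x]; the divisions by [y] and [x] reduce both
     to [c], so the sign of the derivative follows from [psi_le] between [x * t] and [y * t]. *)
  apply: (@is_derive_ge0_le R T (fun t =>
    c * ((f1 (c * (y * t)) - f1 (y * t)) - (f1 (c * (x * t)) - f1 (x * t)))))
    => // t /andP[t0 t1].
    have Dy := @fscaleE y t ltac:(lra) ltac:(lra).
    have Dx := @fscaleE x t ltac:(lra) ltac:(lra).
    rewrite /T; apply: is_derive_eq.
    rewrite /GRing.scale/=; field.
    by rewrite !gt_eqF.
  by rewrite mulr_ge0// subr_ge0 psi_le//; nra.
by rewrite /T !mulr0 !mulr1 f0; lra.
Qed.

Lemma is_derive_lnq (R : realType) (q x : R) :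
  0 < x -> is_derive x 1 (lnq q) (powR x (- q)).
Proof.
move=> x0; rewrite /lnq; have [->|q1] := eqVneq q 1.
  by rewrite powR_inv1 ?ltW//; exact: is_derive1_ln.
have q1' : 1 - q != 0 by rewrite subr_eq0 eq_sym.
have D := is_derive1_powR (1 - q) x0.
apply: is_derive_eq.
rewrite (_ : 1 - q - 1 = - q); last by ring.
by rewrite /GRing.scale/=; field.
Qed.

Lemma lnq1 (R : realType) (q : R) : lnq q 1 = 0.
Proof. by rewrite /lnq ln1 powR1 subrr mul0r if_same. Qed.

(** Pseudo-additivity of the q-logarithm. For [x = 1 + l] the factor in front of [lnq q y] is
    exactly [h_power l q]. *)
Lemma lnqM (R : realType) (q x y : R) : 0 < x -> 0 < y ->
  lnq q (x * y) = lnq q x + powR x (1 - q) * lnq q y.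
Proof.
move=> x0 y0; rewrite /lnq; have [->|q1] := eqVneq q 1.
  by rewrite subrr powRr0 mul1r lnM.
rewrite powRM ?ltW//; field.
by rewrite subr_eq0 eq_sym.
Qed.

(** The reflection of [q] to [2 - q] changes the sign of the exponent [1 - q], as inverting [x]
    does. *)
Lemma lnqV (R : realType) (q x : R) : 0 < x ->
  lnq q x^-1 = - lnq (2 - q) x.
Proof.
move=> x0; rewrite /lnq; have [->|q1] := eqVneq q 1.
  by rewrite (_ : 2 - 1 = 1 :> R) ?eqxx ?lnV//; ring.
rewrite ifF; last by apply/eqP => q2; move/eqP: q1; apply; lra.
rewrite (_ : 1 - (2 - q) = - (1 - q)); last by ring.
rewrite -powR_inv1 ?ltW// -powRrM mulN1r.
by rewrite invrN mulrN opprK.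
Qed.

Lemma is_derive_onem (R : realType) (f : R -> R) (z d : R) :
  is_derive (1 - z) 1 f d -> is_derive z 1 (fun z => f (1 - z)) (- d).
Proof.
move=> fd; have cd : is_derive z 1 (fun z : R => 1 - z) (-1).
  by apply: is_derive_eq; ring.
by rewrite -mulrN1; exact: (@is_derive1_comp R f (fun t => 1 - t)).
Qed.

Lemma is_derive_lnq_onem (R : realType) (q z : R) : z < 1 ->
  is_derive z 1 (fun z => - ((1 - z) * lnq (2 - q) (1 - z)))
    (lnq (2 - q) (1 - z) + powR (1 - z) (q - 1)).
Proof.
move=> z1; have w0 : 0 < 1 - z by lra.
rewrite -[X in is_derive _ _ _ X]opprK.
have D := @is_derive_lnq R (2 - q) _ w0.
apply: (@is_derive_onem R (fun w => - (w * lnq (2 - q) w))).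
apply: is_derive_eq.
rewrite /GRing.scale/= mulr1 addrC; congr (- (_ + _)).
(* With w = 1 - z, the product w * w^(q-2) merges into w^(q-1) once w is written as w^1. *)
rewrite -[X in X * _]powRr1 ?ltW// -powRD; last by apply/implyP => _; rewrite gt_eqF.
by congr (powR _ _); ring.
Qed.

(** With w = 1 - z, the two summands contribute w^(q-2) and (q-1) w^(q-2), and the inner derivative
    -1 gives the sign. *)
Lemma is_derive2_lnq_onem (R : realType) (q z : R) : z < 1 ->
  is_derive z 1 (fun z => lnq (2 - q) (1 - z) + powR (1 - z) (q - 1))
    (- (q * powR (1 - z) (q - 2))).
Proof.
move=> z1; have w0 : 0 < 1 - z by lra.
have D := @is_derive_lnq R (2 - q) _ w0.
have D' := @is_derive1_powR R (q - 1) _ w0.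
apply: (@is_derive_onem R (fun w => lnq (2 - q) w + powR w (q - 1))).
apply: is_derive_eq.
have -> : - (2 - q) = q - 2 by ring.
have -> : q - 1 - 1 = q - 2 by ring.
ring.
Qed.

(** By [lnqM] and [lnqV], multiplying by h turns each [lnq q (1 / y)] into a term in y / (1 + l)
    plus a constant. For y = 1 + l p_i this ratio is 1 - (1 - p_i) x. *)
Lemma tsallis_hypoentropyE (R : realType) (q : R) (n : nat) (p : 'I_n -> R)
    (l : R) (f := fun z => - ((1 - z) * lnq (2 - q) (1 - z)))
    (x := l / (1 + l)) :
  is_distribution p -> 0 < l ->
  tsallis_hypoentropy (@h_power R) q p l =
  \sum_(i < n) (f ((1 - p i) * x) - (1 - p i) * f x) / x.
Proof.
move=> [p0 p1] l0; have u0 : 0 < 1 + l by lra.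
have uN0 : 1 + l != 0 by rewrite gt_eqF.
have lN0 : l != 0 by rewrite gt_eqF.
have y0 i : 0 < 1 + l * p i by have := p0 i; nra.
have hE y : 0 < y -> powR (1 + l) (1 - q) * lnq q (1 / y) =
    - lnq (2 - q) (y / (1 + l)) - lnq q (1 + l).
  move=> yp; rewrite div1r -lnqV ?divr_gt0// invf_div lnqM ?invr_gt0//.
  by ring.
have fiE i : f ((1 - p i) * x) =
    - ((1 + l * p i) / (1 + l) * lnq (2 - q) ((1 + l * p i) / (1 + l))).
  rewrite /f; suff -> : 1 - (1 - p i) * x = (1 + l * p i) / (1 + l) by [].
  by rewrite /x; field.
have fxE : (1 + l) * f x = lnq q (1 + l).
  rewrite /f (_ : 1 - x = (1 + l)^-1); last by rewrite /x; field.
  by rewrite mulrN mulVKf -?lnqV ?invr_gt0 ?invrK.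
rewrite /tsallis_hypoentropy /h_power mulrAC mulrDr mulr_sumr.
have -> : powR (1 + l) (1 - q) * (- (1 + l) * lnq q (1 / (1 + l))) =
    (1 + l) * lnq q (1 + l).
  by rewrite mulrCA hE// divff// lnq1; ring.
under eq_bigr => i _ do rewrite mulrCA hE//.
(* Uses l / x = 1 + l and [fxE]. The subtracted parts are weighted by [p i], so they add up to the
   leading term of the entropy and cancel it. *)
have termE i : (1 + l * p i) *
    (- lnq (2 - q) ((1 + l * p i) / (1 + l)) - lnq q (1 + l)) =
    l * ((f ((1 - p i) * x) - (1 - p i) * f x) / x)
      - p i * ((1 + l) * lnq q (1 + l)).
  rewrite fiE -fxE /x; field.
  by rewrite uN0.
under eq_bigr => i _ do rewrite termE.
rewrite sumrB -mulr_suml p1 mul1r -mulr_sumr addrC subrK mulrC.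
by rewrite mulKf.
Qed.

Theorem proposition3p10 (R : realType) (q : R) (hq0 : 0 <= q) (hq2 : q <= 2)
    (n : nat) (p : 'I_n -> R) (hp : is_distribution p)
    (lambda mu : R) (hlambda : 0 < lambda) (hle : lambda <= mu) :
  tsallis_hypoentropy (@h_power R) q p lambda <=
  tsallis_hypoentropy (@h_power R) q p mu.
Proof.
have hmu : 0 < mu := lt_le_trans hlambda hle.
rewrite !tsallis_hypoentropyE//; apply: ler_sum => i _.
have [p0 p1] := hp.
have pi1 : p i <= 1.
  by rewrite -p1 (bigD1 i)//= lerDl sumr_ge0.
apply: (@jensen_gap_quotient_le R (fun z => - ((1 - z) * lnq (2 - q) (1 - z)))
  (fun z => lnq (2 - q) (1 - z) + powR (1 - z) (q - 1))
  (fun z => - (q * powR (1 - z) (q - 2)))).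
- by rewrite subr0 lnq1 mulr0 oppr0.
- by move=> z /andP[_ z1]; exact: is_derive_lnq_onem.
- by move=> z /andP[_ z1]; exact: is_derive2_lnq_onem.
- by move=> z _; rewrite oppr_le0 mulr_ge0// powR_ge0.
(* The exponent q - 2 is nonpositive, so the power is inverted to compare bases under the
   nonnegative exponent 2 - q. *)
- move=> z w _ zw w1; rewrite lerN2 ler_wpM2l//.
  have -> : q - 2 = - (2 - q) by ring.
  rewrite !powRN lef_pV2 ?posrE ?powR_gt0//; try lra.
  by rewrite ge0_ler_powR ?nnegrE//; lra.
- by have := p0 i; lra.
- by rewrite divr_gt0//; lra.
- rewrite ler_pdivrMr; last by lra.
  by rewrite mulrAC ler_pdivlMr; lra.
- by rewrite ltr_pdivrMr; lra.
Qed.
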